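(* Let $\alpha\in\mathbb{N}_0$. Then $$\left\|e^{-\mathrm{i}tH_\alpha}\right\|_{\ell^1\to\ell^\infty}\le\frac{1}{\sqrt{1+t^2}},\qquad t\in\mathbb{R}.$$ Moreover, in the case $\alpha=0$ the inequality can be replaced by equality, i.e. $\left\|e^{-\mathrm{i}tH_0}\right\|_{\ell^1\to\ell^\infty}=\frac{1}{\sqrt{1+t^2}}$ for all $t\in\mathbb{R}$.
   Context: $\mathbb{N}_0=\{0,1,2,\dots\}$. For $\alpha>-1$, $H_\alpha$ is the (self-adjoint) operator in $\ell^2(\mathbb{N}_0)$ with maximal domain $\{u\in\ell^2(\mathbb{N}_0): \tau_\alpha u\in\ell^2(\mathbb{N}_0)\}$ acting by $H_\alpha u=\tau_\alpha u$, where $$(\tau_\alpha u)_n=\sqrt{n(n+\alpha)}\,u_{n-1}+(2n+1+\alpha)u_n+\sqrt{(n+1)(n+1+\alpha)}\,u_{n+1},\qquad u_{-1}:=0.$$ $e^{-\mathrm{i}tH_\alpha}$ is the associated unitary group on $\ell^2(\mathbb{N}_0)$, and $\|\cdot\|_{\ell^1\to\ell^\infty}$ denotes the operator norm of its restriction to $\ell^1(\mathbb{N}_0)\subset\ell^2(\mathbb{N}_0)$ as a map into $\ell^\infty(\mathbb{N}_0)$ (equivalently, the supremum over $n,m\in\mathbb{N}_0$ of $|\langle\delta_n,e^{-\mathrm{i}tH_\alpha}\delta_m\rangle|$, with $(\delta_n)$ the standard basis). *)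

(* Defs.v *)
From Stdlib Require Import Reals.
From Coquelicot Require Export Coquelicot.

Open Scope R_scope.

(** * Sequence spaces of complex sequences indexed by [nat] *)

Definition in_l1 (u : nat -> C) : Prop := ex_series (fun n => Cmod (u n)).
Definition in_l2 (u : nat -> C) : Prop := ex_series (fun n => Cmod (u n) ^ 2).

Definition norm_l1 (u : nat -> C) : R := Series (fun n => Cmod (u n)).
Definition norm_l2 (u : nat -> C) : R := sqrt (Series (fun n => Cmod (u n) ^ 2)).

(* Valued in [Rbar]: equal to [p_infty] on unbounded sequences. *)
Definition norm_linf (u : nat -> C) : Rbar :=
  Sup_seq (fun n => Finite (Cmod (u n))).

(* Antilinear in the first argument; for [u], [v] in l^2 both series converge
   absolutely. *)
Definition inner_l2 (u v : nat -> C) : C :=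
  (Series (fun n => Re (Cconj (u n) * v n)%C),
   Series (fun n => Im (Cconj (u n) * v n)%C)).

(** * Operators in l^2 *)

(* Everywhere defined operators are maps on all sequences, of which only the
   values on l^2 matter. *)
Record is_unitary (T : (nat -> C) -> (nat -> C)) : Prop := {
  unitary_maps : forall u, in_l2 u -> in_l2 (T u);
  unitary_linear : forall (a b : C) u v, in_l2 u -> in_l2 v ->
    T (fun n => a * u n + b * v n)%C = (fun n => a * T u n + b * T v n)%C;
  unitary_inner : forall u v, in_l2 u -> in_l2 v ->
    inner_l2 (T u) (T v) = inner_l2 u v;
  unitary_surj : forall v, in_l2 v -> exists u, in_l2 u /\ T u = v }.

Record operator : Type := {
  dom : (nat -> C) -> Prop;
  act : (nat -> C) -> (nat -> C) }.

(* [is_exp_group A U] : U(t) = e^{-itA}, that is, U is the strongly continuous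
   one-parameter unitary group on l^2 whose infinitesimal generator is -iA.
   The last field says that the strong derivative of U(t)u at t = 0 exists
   exactly for u in the domain of A, and that it is then -iAu.  By Stone's
   theorem this determines U on l^2 when A is self-adjoint. *)
Record is_exp_group (A : operator) (U : R -> (nat -> C) -> (nat -> C)) : Prop := {
  exp_unitary : forall t, is_unitary (U t);
  exp_zero : forall u, in_l2 u -> U 0 u = u;
  exp_add : forall s t u, in_l2 u -> U (s + t) u = U s (U t u);
  exp_continuous : forall u, in_l2 u -> forall t,
    is_lim (fun s => norm_l2 (fun n => U s u n - U t u n)%C) t 0;
  exp_generator : forall u v, in_l2 u -> in_l2 v ->
    (dom A u /\ act A u = v) <->
    is_lim (fun h => norm_l2 (fun n =>
              (U h u n - u n) / RtoC h - (- Ci * v n))%C) 0 0 }.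

Definition tau (alpha : R) (u : nat -> C) (n : nat) : C :=
  (RtoC (sqrt (INR n * (INR n + alpha)))
     * match n with O => RtoC 0 | S k => u k end
   + RtoC (2 * INR n + 1 + alpha) * u n
   + RtoC (sqrt ((INR n + 1) * (INR n + 1 + alpha))) * u (S n))%C.

(* The operator H_alpha, on its maximal domain. *)
Definition H_op (alpha : R) : operator := {|
  dom := fun u => in_l2 u /\ in_l2 (tau alpha u);
  act := tau alpha |}.

(* Operator norm of the restriction of T to l^1, as a map into l^infty; valued
   in [Rbar], so that it is [p_infty] when this restriction is unbounded. *)
Definition norm_l1_linf (T : (nat -> C) -> (nat -> C)) : Rbar :=
  Rbar_lub (fun y => exists u, in_l1 u /\ norm_l1 u <= 1 /\ y = norm_linf (T u)).

(* Main.v *)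
(** Fix [n].  The entries [m |-> (U t delta_m) n] are bounded by 1 and solve the
infinite system [w_m' = -i (a_m w_(m-1) + b_m w_m + a_(m+1) w_(m+1))].  As the
coefficients grow only linearly in [m], integrating the system [k] times bounds a
bounded solution vanishing at [t0] by a constant times [(16 |t - t0|)^k]; so the
initial values determine bounded solutions, and the entries can be identified
with the explicit solution
[sqrt ((n+alpha)! m! / (n! (m+alpha)!)) (1+it)^-(N+1) p], where
[N = n + m + alpha] and [p] is the coefficient of [z^m] in
[(z-it)^n (1-itz)^(m+alpha)].

Up to the factor [(1+it)^-1] and a phase, this is a matrix element of the
representation of SU(2) on polynomials of degree at most [N], hence it has modulus
at most [1/|1+it|].  The unitarity used is the identity
[sum_k binom(N,k) |c_(k,m)|^2 = binom(N,m) (1+t^2)^N], with [c_(k,m)] the coefficient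
of [z^m] in [(z-it)^k (1-itz)^(N-k)].  For [alpha = 0] the entry [n = m = 0] is
[1/(1+it)], so the bound is attained. *)

Require Import Defs.
From Stdlib Require Import Reals Arith Factorial Lra Lia FunctionalExtensionality.
From Coquelicot Require Import Coquelicot.

(** * The polynomials (z - b)^k (1 - bz)^l *)

(** Used both as a basis vector of l^2 and, for [m = 0], as the constant polynomial 1. *)
Definition delta (m n : nat) : C := if Nat.eqb m n then RtoC 1 else RtoC 0.

(** Multiplication by [z] on coefficient sequences. *)
Definition shift (s : nat -> C) (m : nat) : C :=
  match m with O => RtoC 0 | S j => s j end.

(* Sequences stand for polynomials: [poly_coef b k l m] is the coefficient of
   [z ^ m] in [(z - b) ^ k * (1 - b * z) ^ l]. *)
Definition poly_coef (b : C) (k l : nat) : nat -> C :=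
  Nat.iter k (fun s m => shift s m - b * s m)%C
    (Nat.iter l (fun s m => s m - b * shift s m)%C (delta 0)).

Definition INC (n : nat) : C := RtoC (INR n).

Lemma INC_S (n : nat) : INC (S n) = (INC n + 1)%C.
Proof. unfold INC; rewrite S_INR, RtoC_plus; reflexivity. Qed.

Lemma INC_add (m n : nat) : INC (m + n) = (INC m + INC n)%C.
Proof. unfold INC; rewrite plus_INR, RtoC_plus; reflexivity. Qed.

Lemma shift_ext (s s' : nat -> C) :
  (forall m, s m = s' m) -> forall m, shift s m = shift s' m.
Proof. intros H [|m]; simpl; auto. Qed.

Lemma poly_coef_Sl (b : C) (k l m : nat) :
  poly_coef b (S k) l m = (shift (poly_coef b k l) m - b * poly_coef b k l m)%C.
Proof. reflexivity. Qed.

(** [poly_coef] applies the factors [z - b] last, so an extra factor [1 - b z] has to be commuted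
    past them, by induction on [k]. *)
Lemma poly_coef_Sr (b : C) (k l m : nat) :
  poly_coef b k (S l) m = (poly_coef b k l m - b * shift (poly_coef b k l) m)%C.
Proof.
revert m; induction k as [|k IH]; intros m; [reflexivity|].
rewrite !poly_coef_Sl, (shift_ext _ _ IH), IH.
destruct m as [|m]; cbn [shift]; rewrite ?poly_coef_Sl; ring.
Qed.

(** The factor [INC k] makes the truncation [pred 0 = 0] harmless, which spares later computations a
    case distinction on [k]. *)
Lemma poly_coef_predl (b : C) (k l m : nat) :
  (INC k * poly_coef b k l m =
   INC k * (shift (poly_coef b (pred k) l) m - b * poly_coef b (pred k) l m))%C.
Proof.
destruct k; cbn [pred]; [unfold INC; simpl; ring|].
now rewrite poly_coef_Sl.
Qed.

Lemma poly_coef_predr (b : C) (k l m : nat) :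
  (INC l * poly_coef b k l m =
   INC l * (poly_coef b k (pred l) m - b * shift (poly_coef b k (pred l)) m))%C.
Proof.
destruct l; cbn [pred]; [unfold INC; simpl; ring|].
now rewrite poly_coef_Sr.
Qed.

(* Leibniz rule for [z * d/dz]. *)
Lemma poly_coef_euler (b : C) (k l m : nat) :
  (INC m * poly_coef b k l m =
   INC k * shift (poly_coef b (pred k) l) m
   - b * INC l * shift (poly_coef b k (pred l)) m)%C.
Proof.
assert (I0 : INC 0 = RtoC 0) by reflexivity.
revert m; induction k as [|k IHk]; intros m.
- revert m; induction l as [|l IHl]; intros m.
  + destruct m as [|m]; rewrite ?I0; [ring|].
    replace (poly_coef b 0 0 (S m)) with (RtoC 0) by reflexivity; ring.
  + cbn [pred]. rewrite poly_coef_Sr.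
    destruct m as [|m]; rewrite ?I0; cbn [shift]; [ring|].
    generalize (IHl m) (IHl (S m)) (poly_coef_predr b 0 l m); cbn [shift].
    rewrite !INC_S, I0; intros E1 E2 E3.
    transitivity ((INC m + 1) * poly_coef b 0 l (S m)
       - b * (INC m * poly_coef b 0 l m) - b * poly_coef b 0 l m)%C; [ring|].
    rewrite E1, E2.
    transitivity (- b * (INC l * poly_coef b 0 (pred l) m
       - b * INC l * shift (poly_coef b 0 (pred l)) m + poly_coef b 0 l m))%C; [ring|].
    transitivity (- b * (INC l * poly_coef b 0 l m + poly_coef b 0 l m))%C; [|ring].
    rewrite E3; ring.
- cbn [pred]. rewrite poly_coef_Sl.
  destruct m as [|m]; rewrite ?I0; cbn [shift]; [ring|].
  generalize (IHk m) (IHk (S m)) (poly_coef_predl b k l m); cbn [shift].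
  rewrite !INC_S; intros E1 E2 E3.
  transitivity (INC m * poly_coef b k l m + poly_coef b k l m
     - b * ((INC m + 1) * poly_coef b k l (S m)))%C; [ring|].
  rewrite E1, E2, poly_coef_Sl.
  transitivity (INC k * poly_coef b k l m + poly_coef b k l m
     - b * INC l * (shift (poly_coef b k (pred l)) m - b * poly_coef b k (pred l) m))%C;
    [rewrite E3; ring|ring].
Qed.

(** For [l = m + alpha] this is the differential equation of the kernel after cancelling weights and
    powers of [1 + b]: the left side comes from the time derivative, the right side from the indices
    [m + 1], [m] and [m - 1]. It follows from the Euler identity at [m + 1] and at [m]. *)
Lemma poly_coef_recurrence (b : C) (n l m : nat) :
  ((INC n + INC l + 1) * poly_coef b n l m
   + (1 + b) * (INC n * poly_coef b (pred n) l m
                + INC l * shift (poly_coef b n (pred l)) m) =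
   (INC m + 1) * poly_coef b n (S l) (S m)
   + (INC m + INC l + 1) * (1 + b) * poly_coef b n l m
   + INC l * (1 + b) * (1 + b) * shift (poly_coef b n (pred l)) m)%C.
Proof.
generalize (poly_coef_euler b n (S l) (S m)) (poly_coef_euler b n l m)
  (poly_coef_predl b n l m) (poly_coef_Sr b (pred n) l m).
rewrite !INC_S; cbn [pred]; cbn [shift]; intros E1 E2 E3 E4.
rewrite E1, E4.
transitivity ((INC l + 1) * poly_coef b n l m + INC n * poly_coef b n l m
   + (1 + b) * (INC n * poly_coef b (pred n) l m
                + INC l * shift (poly_coef b n (pred l)) m))%C; [ring|].
rewrite E3.
transitivity (INC n * (poly_coef b (pred n) l m - b * shift (poly_coef b (pred n) l) m)
  - b * (INC l + 1) * poly_coef b n l m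
  + (1 + b) * (INC m * poly_coef b n l m)
  + (INC l + 1) * (1 + b) * poly_coef b n l m
  + INC l * (1 + b) * (1 + b) * shift (poly_coef b n (pred l)) m)%C; [|ring].
rewrite E2; ring.
Qed.

(** * The coefficient bound *)

(* [binomial_sum N g] is the sum over [k + l = N] of [binom(N,k) * g k l]. *)
Fixpoint binomial_sum (N : nat) (g : nat -> nat -> R) : R :=
  match N with
  | O => g O O
  | S N => binomial_sum N (fun k l => g (S k) l + g k (S l))
  end.

Lemma binomial_sum_ext (N : nat) (g h : nat -> nat -> R) :
  (forall k l, g k l = h k l) -> binomial_sum N g = binomial_sum N h.
Proof.
revert g h; induction N as [|N IH]; intros g h H; simpl; [apply H|].
apply IH; intros k l; now rewrite !H.
Qed.

Lemma binomial_sum_le (N : nat) (g h : nat -> nat -> R) :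
  (forall k l, g k l <= h k l) -> binomial_sum N g <= binomial_sum N h.
Proof.
revert g h; induction N as [|N IH]; intros g h H; simpl; [apply H|].
apply IH; intros k l; apply Rplus_le_compat; apply H.
Qed.

Lemma binomial_sum_plus (N : nat) (g h : nat -> nat -> R) :
  binomial_sum N (fun k l => g k l + h k l) = binomial_sum N g + binomial_sum N h.
Proof.
revert g h; induction N as [|N IH]; intros g h; simpl; [reflexivity|].
rewrite <- IH; apply binomial_sum_ext; intros k l; ring.
Qed.

Lemma binomial_sum_scal (N : nat) (c : R) (g : nat -> nat -> R) :
  binomial_sum N (fun k l => c * g k l) = c * binomial_sum N g.
Proof.
revert g; induction N as [|N IH]; intros g; simpl; [reflexivity|].
rewrite <- IH; apply binomial_sum_ext; intros k l; ring.
Qed.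

Definition indicator2 (k l i j : nat) : R :=
  if (Nat.eqb i k && Nat.eqb j l)%bool then 1 else 0.

Lemma binomial_sum_zero (N : nat) : binomial_sum N (fun _ _ => 0) = 0.
Proof.
rewrite (binomial_sum_ext N _ (fun k l => 0 * 0)) by (intros; ring).
rewrite binomial_sum_scal; ring.
Qed.

(** Pascal's rule: the sum is [binom(k+l, k)], with the factorials multiplied out to avoid
    division. *)
Lemma binomial_sum_indicator2 (k l : nat) :
  binomial_sum (k + l) (indicator2 k l) * (INR (fact k) * INR (fact l)) =
  INR (fact (k + l)).
Proof.
remember (k + l)%nat as N eqn:HN; revert k l HN.
induction N as [|N IH]; intros k l HN.
- assert (k = 0%nat) by lia; assert (l = 0%nat) by lia; subst; simpl; unfold indicator2; simpl; ring.
- cbn [binomial_sum]. rewrite binomial_sum_plus.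
  assert (HS : forall p, INR (fact (S p)) = (INR p + 1) * INR (fact p))
    by (intros p; rewrite fact_simpl, mult_INR, S_INR; reflexivity).
  rewrite HS, Rmult_plus_distr_r.
  (* The factor [N + 1 = k + l] splits the right side to match the two recursive sums. *)
  replace (INR N + 1) with (INR k + INR l)
    by (rewrite <- plus_INR, <- HN, S_INR; reflexivity).
  rewrite Rmult_plus_distr_r; f_equal.
  + destruct k as [|k].
    * rewrite (binomial_sum_ext N _ (fun _ _ => 0)) by reflexivity.
      rewrite binomial_sum_zero; simpl; ring.
    * rewrite (binomial_sum_ext N _ (indicator2 k l)) by reflexivity.
      rewrite <- (IH k l) by lia; rewrite HS, S_INR; ring.
  + destruct l as [|l].
    * rewrite (binomial_sum_ext N _ (fun _ _ => 0));
        [rewrite binomial_sum_zero; simpl; ring|].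
      intros i j; unfold indicator2; cbn; now rewrite Bool.andb_false_r.
    * rewrite (binomial_sum_ext N _ (indicator2 k l)) by reflexivity.
      rewrite <- (IH k l) by lia; rewrite HS, S_INR; ring.
Qed.

(** Since [g] is nonnegative, it dominates [g k l] times the indicator of [(k, l)]. *)
Lemma binomial_sum_term_le (k l : nat) (g : nat -> nat -> R) :
  (forall i j, 0 <= g i j) ->
  INR (fact (k + l)) * g k l <=
  binomial_sum (k + l) g * (INR (fact k) * INR (fact l)).
Proof.
intros Hg; rewrite <- binomial_sum_indicator2.
assert (Hf : 0 <= INR (fact k) * INR (fact l))
  by (apply Rmult_le_pos; apply pos_INR).
replace (binomial_sum (k + l) (indicator2 k l) * (INR (fact k) * INR (fact l)) * g k l)
  with (g k l * binomial_sum (k + l) (indicator2 k l) * (INR (fact k) * INR (fact l)))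
  by ring.
apply Rmult_le_compat_r; [exact Hf|].
rewrite <- binomial_sum_scal; apply binomial_sum_le; intros i j; unfold indicator2.
generalize (Hg i j).
destruct (Nat.eqb_spec i k) as [->|], (Nat.eqb_spec j l) as [->|]; simpl; lra.
Qed.

(* The matrix [((1, -it), (-it, 1))] is [sqrt (1 + t ^ 2)] times a unitary one. *)
Lemma Cmod_sqr_rotation (t : R) (x y : C) :
  Cmod (x - Ci * t * y)%C ^ 2 + Cmod (y - Ci * t * x)%C ^ 2 =
  (1 + t ^ 2) * (Cmod x ^ 2 + Cmod y ^ 2).
Proof.
unfold Cmod; rewrite !pow2_sqrt by (apply Rplus_le_le_0_compat; apply pow2_ge_0).
destruct x, y; simpl; ring.
Qed.

(** * The unitarity identity for the coefficients *)

Definition poly_energy (t : R) (N m : nat) : R :=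
  binomial_sum N (fun k l => Cmod (poly_coef (Ci * t) k l m) ^ 2).

(** Each pair [(k, l)] contributes the coefficients after one more factor [z - it] and after one
    more factor [1 - itz]. Together these are the image of the coefficients at [m - 1] and [m] under
    the matrix of [Cmod_sqr_rotation]. *)
Lemma poly_energy_S (t : R) (N m : nat) :
  poly_energy t (S N) m =
  (1 + t ^ 2) *
    (poly_energy t N m + match m with O => 0 | S j => poly_energy t N j end).
Proof.
unfold poly_energy at 1; cbn [binomial_sum].
rewrite (binomial_sum_ext N _ (fun k l => (1 + t ^ 2) *
  (Cmod (poly_coef (Ci * t) k l m) ^ 2 + Cmod (shift (poly_coef (Ci * t) k l) m) ^ 2))).
- rewrite binomial_sum_scal, binomial_sum_plus; f_equal; f_equal.
  destruct m as [|m]; [|reflexivity].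
  rewrite <- (binomial_sum_zero N); apply binomial_sum_ext; intros k l.
  cbn [shift]; rewrite Cmod_0; ring.
- intros k l; rewrite poly_coef_Sl, poly_coef_Sr, Cmod_sqr_rotation; ring.
Qed.

Lemma poly_energy_0 (t : R) (m : nat) :
  poly_energy t 0 m = match m with O => 1 | S _ => 0 end.
Proof.
unfold poly_energy, poly_coef, delta; simpl.
destruct m; simpl; rewrite ?Cmod_0, ?Cmod_1; ring.
Qed.

(** A product of [N] linear factors has degree at most [N]. *)
Lemma poly_energy_gt (t : R) (N m : nat) : (N < m)%nat -> poly_energy t N m = 0.
Proof.
revert m; induction N as [|N IH]; intros m H.
- rewrite poly_energy_0; destruct m; [lia|reflexivity].
- rewrite poly_energy_S; destruct m; [lia|].
  rewrite !IH by lia; ring.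
Qed.

(** Up to the factor [1 + t^2], [poly_energy_S] is Pascal's rule, so the energy is [binom(m+j, m)]
    times [(1 + t^2)^(m+j)]. *)
Lemma poly_energy_eq (t : R) (m j : nat) :
  poly_energy t (m + j) m * (INR (fact m) * INR (fact j)) =
  INR (fact (m + j)) * (1 + t ^ 2) ^ (m + j).
Proof.
remember (m + j)%nat as N eqn:HN; revert m j HN.
induction N as [|N IH]; intros m j HN.
- assert (m = 0%nat) by lia; assert (j = 0%nat) by lia; subst.
  rewrite poly_energy_0; simpl; ring.
- assert (HS : forall p, INR (fact (S p)) = (INR p + 1) * INR (fact p))
    by (intros p; rewrite fact_simpl, mult_INR, S_INR; reflexivity).
  rewrite poly_energy_S, HS; cbn [pow].
  replace (INR N + 1) with (INR m + INR j)
    by (rewrite <- plus_INR, <- HN, S_INR; reflexivity).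
  transitivity ((1 + t * (t * 1)) *
     (INR j * (INR (fact N) * (1 + t ^ 2) ^ N) + INR m * (INR (fact N) * (1 + t ^ 2) ^ N)));
    [|cbn [pow]; ring].
  rewrite Rmult_assoc; f_equal; rewrite Rmult_plus_distr_r; f_equal.
  + destruct j as [|j].
    * rewrite poly_energy_gt by lia; simpl; ring.
    * rewrite <- (IH m j) by lia; rewrite HS, S_INR; ring.
  + destruct m as [|m]; [simpl; ring|].
    rewrite <- (IH m j) by lia; rewrite HS, S_INR; ring.
Qed.

(** Only the term [(k, l)] of the energy is kept. *)
Lemma poly_coef_bound (t : R) (k l m j : nat) :
  (k + l = m + j)%nat ->
  Cmod (poly_coef (Ci * t) k l m) ^ 2 * (INR (fact m) * INR (fact j)) <=
  INR (fact k) * INR (fact l) * (1 + t ^ 2) ^ (k + l).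
Proof.
intros H.
generalize (binomial_sum_term_le k l
  (fun k l => Cmod (poly_coef (Ci * t) k l m) ^ 2) (fun i j => pow2_ge_0 _)).
generalize (poly_energy_eq t m j); rewrite <- H; unfold poly_energy.
set (S := binomial_sum _ _); intros E L.
apply (Rmult_le_reg_l (INR (fact (k + l)))); [apply INR_fact_lt_0|].
apply (Rmult_le_compat_r (INR (fact m) * INR (fact j))) in L;
  [|apply Rmult_le_pos; apply pos_INR].
rewrite <- Rmult_assoc; eapply Rle_trans; [exact L|].
apply Req_le; transitivity (INR (fact k) * INR (fact l) *
  (S * (INR (fact m) * INR (fact j)))); [ring|rewrite E; ring].
Qed.

(** * Derivatives in time *)

(** Componentwise, so that mean value estimates apply to the real and imaginary parts separately. *)
Definition is_derive_C (f : R -> C) (t : R) (l : C) : Prop :=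
  is_derive (fun s => Re (f s)) t (Re l) /\ is_derive (fun s => Im (f s)) t (Im l).

Lemma is_derive_C_ext (f g : R -> C) (t : R) (l : C) :
  (forall s, f s = g s) -> is_derive_C f t l -> is_derive_C g t l.
Proof.
intros H [Hr Hi]; split; eapply is_derive_ext; [|exact Hr| |exact Hi];
  intros s; simpl; now rewrite H.
Qed.

Lemma is_derive_C_const (c : C) (t : R) : is_derive_C (fun _ => c) t (RtoC 0).
Proof. split; [apply (is_derive_const (Re c))|apply (is_derive_const (Im c))]. Qed.

Lemma is_derive_C_minus (f g : R -> C) (t : R) (df dg : C) :
  is_derive_C f t df -> is_derive_C g t dg ->
  is_derive_C (fun s => f s - g s)%C t (df - dg)%C.
Proof.
intros [Fr Fi] [Gr Gi]; split;
  [exact (is_derive_minus _ _ _ _ _ Fr Gr)|exact (is_derive_minus _ _ _ _ _ Fi Gi)].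
Qed.

Lemma is_derive_C_mult (f g : R -> C) (t : R) (df dg : C) :
  is_derive_C f t df -> is_derive_C g t dg ->
  is_derive_C (fun s => f s * g s)%C t (df * g t + f t * dg)%C.
Proof.
intros [Fr Fi] [Gr Gi].
generalize (is_derive_mult _ _ _ _ _ Fr Gr Rmult_comm)
  (is_derive_mult _ _ _ _ _ Fi Gi Rmult_comm)
  (is_derive_mult _ _ _ _ _ Fr Gi Rmult_comm)
  (is_derive_mult _ _ _ _ _ Fi Gr Rmult_comm).
intros H1 H2 H3 H4; split.
- evar_last; [exact (is_derive_minus _ _ _ _ _ H1 H2)|].
  unfold minus, plus, opp, mult; simpl; unfold mult; simpl; unfold Re, Im; ring.
- evar_last; [exact (is_derive_plus _ _ _ _ _ H3 H4)|].
  unfold plus, mult; simpl; unfold mult; simpl; unfold Re, Im; ring.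
Qed.

Lemma is_derive_C_imag (t : R) : is_derive_C (fun s => Ci * RtoC s)%C t Ci.
Proof.
split; simpl; unfold Re, Im; simpl; auto_derive; auto; ring.
Qed.

Lemma one_plus_imag_neq_0 (t : R) : (1 + Ci * t)%C <> RtoC 0.
Proof. intros H; apply (f_equal Re) in H; simpl in H; lra. Qed.

Lemma is_derive_C_inv_pow (N : nat) (t : R) :
  is_derive_C (fun s => (/ (1 + Ci * s)) ^ N)%C t
    (- Ci * INC N * (/ (1 + Ci * t)) ^ S N)%C.
Proof.
induction N as [|N IH].
- apply (is_derive_C_ext (fun _ => RtoC 1)); [reflexivity|].
  replace (- Ci * INC 0 * _)%C with (RtoC 0) by (unfold INC; simpl; ring).
  apply is_derive_C_const.
- apply (is_derive_C_ext (fun s => / (1 + Ci * s) * (/ (1 + Ci * s)) ^ N)%C);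
    [reflexivity|].
  replace (- Ci * INC (S N) * (/ (1 + Ci * t)) ^ S (S N))%C with
   (- Ci * (/ (1 + Ci * t)) ^ 2 * (/ (1 + Ci * t)) ^ N
    + / (1 + Ci * t) * (- Ci * INC N * (/ (1 + Ci * t)) ^ S N))%C
    by (rewrite INC_S; simpl; ring).
  apply (is_derive_C_mult (fun s => / (1 + Ci * s))%C); [|exact IH].
  (* What remains is the derivative of [1/(1+is)], computed on its real and imaginary parts. *)
  split; simpl; unfold Re, Im; simpl; auto_derive; try (field); nra.
Qed.

Lemma is_derive_C_shift (f df : R -> nat -> C) (t : R) :
  (forall m, is_derive_C (fun s => f s m) t (df t m)) ->
  forall m, is_derive_C (fun s => shift (f s) m) t (shift (df t) m).
Proof. intros H [|m]; cbn [shift]; [apply is_derive_C_const|apply H]. Qed.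

(** Leibniz rule in time: [z - it] has derivative [-i], and [1 - itz] has derivative [-iz], whence
    the shift. *)
Lemma is_derive_C_poly_coef (k l m : nat) (t : R) :
  is_derive_C (fun s => poly_coef (Ci * s) k l m) t
    (- Ci * (INC k * poly_coef (Ci * t) (pred k) l m
             + INC l * shift (poly_coef (Ci * t) k (pred l)) m))%C.
Proof.
revert m; induction k as [|k IHk]; intros m.
- revert m; induction l as [|l IHl]; intros m.
  + replace (- Ci * _)%C with (RtoC 0) by (unfold INC; simpl; ring).
    exact (is_derive_C_const (delta 0 m) t).
  + eapply is_derive_C_ext; [intros s; symmetry; apply poly_coef_Sr|].
    cbn [pred] in *.
    assert (H : forall m, is_derive_C (fun s => poly_coef (Ci * s) 0 l m) t
       (- Ci * INC l * shift (poly_coef (Ci * t) 0 (pred l)) m)%C).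
    { intros j; evar_last; [exact (IHl j)|unfold INC; simpl; ring]. }
    evar_last; [exact (is_derive_C_minus _ _ _ _ _ (H m) (is_derive_C_mult _ _ _ _ _
      (is_derive_C_imag t) (is_derive_C_shift _ (fun _ m =>
        (- Ci * INC l * shift (poly_coef (Ci * t) 0 (pred l)) m)%C) _ H m)))|].
    rewrite INC_S; replace (INC 0) with (RtoC 0) by reflexivity.
    destruct m as [|m]; cbn [shift]; [ring|].
    generalize (poly_coef_predr (Ci * t) 0 l m); intros E.
    transitivity (- Ci * (INC l * (poly_coef (Ci * t) 0 (pred l) m
      - Ci * t * shift (poly_coef (Ci * t) 0 (pred l)) m)
      + poly_coef (Ci * t) 0 l m))%C; [ring|].
    rewrite <- E; ring.
- eapply is_derive_C_ext; [intros s; symmetry; apply poly_coef_Sl|].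
  cbn [pred] in *.
  evar_last; [exact (is_derive_C_minus _ _ _ _ _ (is_derive_C_shift _ (fun _ m =>
     (- Ci * (INC k * poly_coef (Ci * t) (pred k) l m
             + INC l * shift (poly_coef (Ci * t) k (pred l)) m))%C) _ IHk m)
    (is_derive_C_mult _ _ _ _ _ (is_derive_C_imag t) (IHk m)))|].
  rewrite INC_S.
  generalize (poly_coef_predl (Ci * t) k l m); intros E.
  assert (E' : shift (poly_coef (Ci * t) (S k) (pred l)) m =
     (shift (shift (poly_coef (Ci * t) k (pred l))) m
      - Ci * t * shift (poly_coef (Ci * t) k (pred l)) m)%C).
  { destruct m; cbn [shift]; [ring|]; apply poly_coef_Sl. }
  transitivity (- Ci * (INC k * (shift (poly_coef (Ci * t) (pred k) l) m
     - Ci * t * poly_coef (Ci * t) (pred k) l m) + poly_coef (Ci * t) k l m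
     + INC l * (shift (shift (poly_coef (Ci * t) k (pred l))) m
      - Ci * t * shift (poly_coef (Ci * t) k (pred l)) m)))%C.
  + destruct m; cbn [shift]; ring.
  + rewrite <- E, <- E'; ring.
Qed.

(** * The explicit kernel *)

(** The matrix entry linking [m - 1] and [m]. It vanishes at [m = 0], which takes care of the
    boundary. *)
Definition offdiag (alpha m : nat) : R := sqrt (INR m * (INR m + INR alpha)).

Definition diag (alpha m : nat) : R := 2 * INR m + 1 + INR alpha.

(** The norm of the Laguerre polynomial of degree [m] for the weight [x^alpha e^(-x)]. Rescaling by
    it turns the square roots of the operator into integer coefficients. *)
Definition weight (alpha m : nat) : R := sqrt (INR (fact (m + alpha)) / INR (fact m)).

Lemma weight_pos (alpha m : nat) : 0 < weight alpha m.
Proof. apply sqrt_lt_R0, Rdiv_lt_0_compat; apply INR_fact_lt_0. Qed.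

Lemma weight_sqr (alpha m : nat) :
  weight alpha m ^ 2 = INR (fact (m + alpha)) / INR (fact m).
Proof.
apply pow2_sqrt, Rlt_le, Rdiv_lt_0_compat; apply INR_fact_lt_0.
Qed.

Lemma weight_S_sqr (alpha m : nat) :
  weight alpha (S m) ^ 2 * INR (S m) = weight alpha m ^ 2 * (INR (S m) + INR alpha).
Proof.
rewrite !weight_sqr; change (S m + alpha)%nat with (S (m + alpha)); rewrite !fact_simpl, !mult_INR.
replace (INR (S (m + alpha))) with (INR (S m) + INR alpha)
  by (rewrite <- plus_INR; f_equal; lia).
field; split; [apply INR_fact_neq_0|apply not_0_INR; lia].
Qed.

Lemma offdiag_nonneg (alpha m : nat) : 0 <= offdiag alpha m.
Proof. apply sqrt_pos. Qed.

Lemma offdiag_sqr (alpha m : nat) :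
  offdiag alpha m ^ 2 = INR m * (INR m + INR alpha).
Proof.
apply pow2_sqrt, Rmult_le_pos; [|apply Rplus_le_le_0_compat]; apply pos_INR.
Qed.

Lemma eq_of_sqr (x y : R) : 0 <= x -> 0 <= y -> x ^ 2 = y ^ 2 -> x = y.
Proof. intros Hx Hy H; apply Rsqr_inj; auto; unfold Rsqr; nra. Qed.

(** Both sides are nonnegative and their squares agree by the factorial recursion. This lemma and
    [offdiag_weight_pred] remove the square roots from the equation of the kernel. *)
Lemma offdiag_weight_S (alpha m : nat) :
  offdiag alpha (S m) * weight alpha m = INR (S m) * weight alpha (S m).
Proof.
generalize (weight_pos alpha m) (weight_pos alpha (S m)) (offdiag_nonneg alpha (S m))
  (pos_INR (S m)); intros.
apply eq_of_sqr; try (apply Rmult_le_pos; lra).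
rewrite !Rpow_mult_distr, offdiag_sqr.
transitivity (INR (S m) * (weight alpha m ^ 2 * (INR (S m) + INR alpha))); [ring|].
rewrite <- weight_S_sqr; ring.
Qed.

Lemma offdiag_weight_pred (alpha m : nat) :
  offdiag alpha (S m) * weight alpha (S m) = (INR (S m) + INR alpha) * weight alpha m.
Proof.
generalize (weight_pos alpha m) (weight_pos alpha (S m)) (offdiag_nonneg alpha (S m))
  (pos_INR (S m)) (pos_INR alpha); intros.
apply eq_of_sqr; try (apply Rmult_le_pos; lra).
rewrite !Rpow_mult_distr, offdiag_sqr.
transitivity ((INR (S m) + INR alpha) * (weight alpha (S m) ^ 2 * INR (S m))); [ring|].
rewrite weight_S_sqr; ring.
Qed.

Definition kernel (alpha n m : nat) (t : R) : C :=
  (RtoC (weight alpha n / weight alpha m) * (/ (1 + Ci * t)) ^ S (n + m + alpha)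
   * poly_coef (Ci * t) n (m + alpha) m)%C.

Lemma kernel_0 (alpha n m : nat) : kernel alpha n m 0 = delta m n.
Proof.
unfold kernel.
(* At [b = 0] the polynomial is [z^n]. *)
replace (poly_coef (Ci * 0) n (m + alpha) m) with (delta n m).
- unfold delta; rewrite (Nat.eqb_sym m n).
  destruct (Nat.eqb_spec n m) as [->|]; [|ring].
  replace (weight alpha m / weight alpha m) with 1
    by (field; apply Rgt_not_eq, weight_pos).
  replace (/ (1 + Ci * 0))%C with (RtoC 1) by (field; apply C1_nz).
  rewrite Cpow_1_l; ring.
- generalize (m + alpha)%nat; intros l; revert m; induction n as [|n IH]; intros m.
  + induction l as [|l IHl]; [reflexivity|].
    rewrite poly_coef_Sr, <- IHl; ring.
  + rewrite poly_coef_Sl, <- IH.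
    destruct m as [|m]; cbn [shift]; [unfold delta; simpl; ring|].
    rewrite <- IH; unfold delta; simpl; ring.
Qed.

(** Once the weights have absorbed the off-diagonal entries, the product rule reduces the claim to
    [poly_coef_recurrence] with [l = m + alpha]. *)
Lemma kernel_derive (alpha n m : nat) (t : R) :
  is_derive_C (kernel alpha n m) t
    (- Ci * (offdiag alpha m * kernel alpha n (pred m) t
             + diag alpha m * kernel alpha n m t
             + offdiag alpha (S m) * kernel alpha n (S m) t))%C.
Proof.
unfold kernel at 1.
evar_last.
{ apply is_derive_C_mult; [apply is_derive_C_mult;
    [apply is_derive_C_const|apply is_derive_C_inv_pow]|apply is_derive_C_poly_coef]. }
set (b := (Ci * t)%C).
assert (H1b : (1 + b)%C <> RtoC 0) by apply one_plus_imag_neq_0.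
set (N := (n + m + alpha)%nat).
set (w := / weight alpha m).
assert (Hw : weight alpha m <> 0) by apply Rgt_not_eq, weight_pos.
set (v := weight alpha n).
assert (Hup : (offdiag alpha (S m) * kernel alpha n (S m) t =
  v * w * INC (S m) * (/ (1 + b)) ^ S (S N) * poly_coef b n (S (m + alpha)) (S m))%C).
{ unfold kernel; fold b v.
  replace (S (n + S m + alpha)) with (S (S N)) by (unfold N; lia).
  replace (S m + alpha)%nat with (S (m + alpha)) by lia.
  rewrite !Cmult_assoc; do 2 f_equal.
  unfold INC; rewrite <- !RtoC_mult; f_equal; unfold w.
  apply (Rmult_eq_reg_r (weight alpha m * weight alpha (S m)));
    [|apply Rmult_integral_contrapositive_currified; [exact Hw|
       apply Rgt_not_eq, weight_pos]].
  transitivity (v * (offdiag alpha (S m) * weight alpha m));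
    [field; apply Rgt_not_eq, weight_pos|].
  rewrite offdiag_weight_S; field; exact Hw. }
assert (Hdown : (offdiag alpha m * kernel alpha n (pred m) t =
  v * w * INC (m + alpha) * (/ (1 + b)) ^ N * shift (poly_coef b n (pred (m + alpha))) m)%C).
(* At [m = 0] both sides vanish, through [offdiag alpha 0 = 0] and through [shift]. *)
{ destruct m as [|m].
  - replace (offdiag alpha 0) with 0
      by (unfold offdiag; simpl; rewrite Rmult_0_l, sqrt_0; reflexivity).
    cbn [shift]; ring.
  - cbn [pred shift plus]; unfold kernel; fold b v.
    replace (S (n + m + alpha)) with N by (unfold N; lia).
    rewrite !Cmult_assoc; do 2 f_equal.
    unfold INC; rewrite <- !RtoC_mult; f_equal; unfold w.
    assert (Hm : weight alpha m <> 0) by apply Rgt_not_eq, weight_pos.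
    apply (Rmult_eq_reg_r (weight alpha m * weight alpha (S m)));
      [|now apply Rmult_integral_contrapositive_currified].
    transitivity (v * (offdiag alpha (S m) * weight alpha (S m))); [field; exact Hm|].
    rewrite offdiag_weight_pred, <- plus_INR; cbn [plus]; field; exact Hw. }
rewrite Hup, Hdown.
assert (Hd : RtoC (diag alpha m) = (INC m + INC (m + alpha) + 1)%C).
{ unfold INC, diag; rewrite plus_INR, <- !RtoC_plus; f_equal; ring. }
rewrite Hd; unfold kernel; fold b v N.
replace (RtoC (v / weight alpha m)) with (v * w)%C
  by (rewrite <- RtoC_mult; reflexivity).
assert (HN : INC (S N) = (INC n + INC (m + alpha) + 1)%C)
  by (rewrite <- INC_add, <- INC_S; f_equal; unfold N; lia).
rewrite HN, INC_S.
generalize (poly_coef_recurrence b n (m + alpha) m).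
(* All powers of [1/(1+b)] are expressed through the one of exponent [N + 2], which then factors
   out. *)
assert (Hp1 : ((/ (1 + b)) ^ S N = (/ (1 + b)) ^ S (S N) * (1 + b))%C)
  by (rewrite !Cpow_S; field; exact H1b).
assert (Hp0 : ((/ (1 + b)) ^ N = (/ (1 + b)) ^ S (S N) * (1 + b) * (1 + b))%C)
  by (rewrite !Cpow_S; field; exact H1b).
rewrite Hp1, Hp0; generalize ((/ (1 + b)) ^ S (S N))%C.
intros p E.
transitivity (- Ci * v * w * p * ((INC n + INC (m + alpha) + 1) * poly_coef b n (m + alpha) m
  + (1 + b) * (INC n * poly_coef b (pred n) (m + alpha) m
                + INC (m + alpha) * shift (poly_coef b n (pred (m + alpha))) m)))%C;
  [|rewrite E]; ring.
Qed.

Lemma Cmod_one_plus_imag (t : R) : Cmod (1 + Ci * t)%C = sqrt (1 + t ^ 2).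
Proof. unfold Cmod; f_equal; simpl; ring. Qed.

Lemma Cmod_kernel_le (alpha n m : nat) (t : R) :
  Cmod (kernel alpha n m t) <= 1 / sqrt (1 + t ^ 2).
Proof.
assert (Ht : 0 < 1 + t ^ 2) by (generalize (pow2_ge_0 t); lra).
assert (Hs : 0 < sqrt (1 + t ^ 2)) by now apply sqrt_lt_R0.
apply Rsqr_incr_0_var; [|apply Rlt_le, Rdiv_lt_0_compat; lra].
rewrite !Rsqr_pow2; unfold kernel.
rewrite !Cmod_mult, Cmod_pow, Cmod_inv, Cmod_one_plus_imag by apply one_plus_imag_neq_0.
rewrite Cmod_R, !Rpow_mult_distr, pow2_abs.
replace ((/ sqrt (1 + t ^ 2)) ^ S (n + m + alpha)) with (/ sqrt (1 + t ^ 2) ^ S (n + m + alpha))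
  by (now rewrite pow_inv).
unfold Rdiv; rewrite !Rpow_mult_distr, !pow_inv, !weight_sqr.
rewrite <- !pow_mult, (Nat.mul_comm _ 2), pow_mult, pow2_sqrt by lra.
(* [N] splits as [n + (m + alpha)] and as [m + (n + alpha)]; the resulting factorials are exactly
   those of the squared weights. *)
generalize (poly_coef_bound t n (m + alpha) m (n + alpha) ltac:(lia)).
replace (n + (m + alpha))%nat with (n + m + alpha)%nat by lia.
set (c := Cmod _ ^ 2); set (N := (n + m + alpha)%nat); intros H.
generalize (INR_fact_lt_0 n) (INR_fact_lt_0 m) (INR_fact_lt_0 (n + alpha))
  (INR_fact_lt_0 (m + alpha)) (pow_lt (1 + t ^ 2) N Ht); intros.
cbn [pow] in *.
set (T := 1 + t * (t * 1)) in *.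
set (P := T ^ N) in *.
apply (Rmult_le_reg_r (INR (fact n) * INR (fact (m + alpha)) * P * T));
  [repeat apply Rmult_lt_0_compat; assumption|].
match goal with |- ?l <= ?r =>
  replace l with (c * (INR (fact m) * INR (fact (n + alpha)))) by (field; lra);
  replace r with (INR (fact n) * INR (fact (m + alpha)) * P) by (field; lra)
end.
exact H.
Qed.

(** * Uniqueness of bounded solutions *)

(** The difference [K s^(k+1)/(k+1) - g s] vanishes at 0 and has nonnegative derivative for
    [s >= 0]. *)
Lemma le_of_derive_le_pow (g dg : R -> R) (K : R) (k : nat) (t : R) :
  0 <= t -> g 0 = 0 -> (forall s, is_derive g s (dg s)) ->
  (forall s, 0 <= s -> dg s <= K * s ^ k) ->
  g t <= K * t ^ S k / INR (S k).
Proof.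
intros Ht H0 Hd Hb.
assert (Hk : INR (S k) <> 0) by (apply not_0_INR; lia).
assert (D : forall s, is_derive (fun s => K * s ^ S k / INR (S k) - g s) s (K * s ^ k - dg s)).
{ intros s; evar_last.
  - apply (is_derive_minus (fun s => K * s ^ S k / INR (S k)) g); [|apply Hd].
    apply (is_derive_ext (fun s => (K / INR (S k)) * s ^ S k)).
    + intros u; simpl; field; exact Hk.
    + apply is_derive_scal, is_derive_pow, is_derive_id.
  - unfold minus, plus, opp, one; simpl pred; cbn -[INR pow]; field; exact Hk. }
destruct (MVT_gen (fun s => K * s ^ S k / INR (S k) - g s) 0 t
  (fun s => K * s ^ k - dg s)) as [c [Hc E]].
- intros; apply D.
- intros x _; apply derivable_continuous_pt.
  exists (K * x ^ k - dg x); apply is_derive_Reals, D.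
- rewrite Rmin_left, Rmax_right in Hc by lra.
  rewrite H0 in E; cbn beta in E.
  replace (K * 0 ^ S k / INR (S k)) with 0 in E by (simpl pow; field; exact Hk).
  generalize (Rmult_le_pos (K * c ^ k - dg c) (t - 0)); generalize (Hb c); lra.
Qed.

Lemma Rabs_le_of_derive_le_pow (g dg : R -> R) (K : R) (k : nat) (t0 : R) :
  g t0 = 0 -> (forall s, is_derive g s (dg s)) ->
  (forall s, Rabs (dg s) <= K * Rabs (s - t0) ^ k) ->
  forall t, Rabs (g t) <= K * Rabs (t - t0) ^ S k / INR (S k).
Proof.
intros H0 Hd Hb.
(* [e] reflects time about [t0] and [e'] flips the sign of [g]; the four choices reduce the
   two-sided estimate to the one-sided one. *)
assert (Main : forall e e' : R, Rabs e = 1 -> Rabs e' = 1 -> forall s, 0 <= s ->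
   e' * g (t0 + e * s) <= K * s ^ S k / INR (S k)).
{ intros e e' He He' s Hs.
  apply (le_of_derive_le_pow (fun s => e' * g (t0 + e * s))
    (fun s => e' * (e * dg (t0 + e * s)))); [exact Hs| | |].
  - rewrite Rmult_0_r, Rplus_0_r, H0; ring.
  - intros u; apply is_derive_scal.
    apply (is_derive_comp g (fun u => t0 + e * u)); [apply Hd|].
    auto_derive; [auto|ring].
  - intros u Hu; eapply Rle_trans; [apply Rle_abs|].
    rewrite !Rabs_mult, He, He', !Rmult_1_l.
    eapply Rle_trans; [apply Hb|].
    replace (t0 + e * u - t0) with (e * u) by ring.
    rewrite Rabs_mult, He, Rmult_1_l, (Rabs_right u) by lra; lra. }
assert (A1 : Rabs 1 = 1) by apply Rabs_R1.
assert (A2 : Rabs (-1) = 1) by (rewrite Rabs_left; lra).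
intros t; apply Rabs_le.
destruct (Rle_dec 0 (t - t0)) as [Hs|Hs].
- rewrite (Rabs_right (t - t0)) by lra.
  generalize (Main 1 1 A1 A1 (t - t0) Hs) (Main 1 (-1) A1 A2 (t - t0) Hs).
  replace (t0 + 1 * (t - t0)) with t by ring; lra.
- rewrite (Rabs_left (t - t0)) by lra.
  generalize (Main (-1) 1 A2 A1 (- (t - t0)) ltac:(lra))
    (Main (-1) (-1) A2 A2 (- (t - t0)) ltac:(lra)).
  replace (t0 + -1 * - (t - t0)) with t by ring; lra.
Qed.

Lemma Im_le_Cmod (c : C) : Rabs (Im c) <= Cmod c.
Proof. eapply Rle_trans; [apply Rmax_r|apply Rmax_Cmod]. Qed.

Lemma Cmod_le_Re_Im (c : C) : Cmod c <= Rabs (Re c) + Rabs (Im c).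
Proof.
replace c with (RtoC (Re c) + Ci * RtoC (Im c))%C at 1
  by (destruct c; apply injective_projections; simpl; ring).
eapply Rle_trans; [apply Cmod_triangle|].
rewrite Cmod_mult, !Cmod_R, Cmod_Ci; lra.
Qed.

(** The factor 2 comes from adding the bounds for the real and imaginary parts. *)
Lemma Cmod_le_of_derive_le_pow (f df : R -> C) (K : R) (k : nat) (t0 : R) :
  f t0 = RtoC 0 -> (forall s, is_derive_C f s (df s)) ->
  (forall s, Cmod (df s) <= K * Rabs (s - t0) ^ k) ->
  forall t, Cmod (f t) <= 2 * K * Rabs (t - t0) ^ S k / INR (S k).
Proof.
intros H0 Hd Hb t.
generalize (Rabs_le_of_derive_le_pow (fun s => Re (f s)) (fun s => Re (df s)) K k t0
   (f_equal Re H0) (fun s => proj1 (Hd s))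
   (fun s => Rle_trans _ _ _ (re_le_Cmod _) (Hb s)) t)
 (Rabs_le_of_derive_le_pow (fun s => Im (f s)) (fun s => Im (df s)) K k t0
   (f_equal Im H0) (fun s => proj2 (Hd s))
   (fun s => Rle_trans _ _ _ (Im_le_Cmod _) (Hb s)) t) (Cmod_le_Re_Im (f t)); lra.
Qed.

(** * Binomial coefficients, with [binom p k] standing for [p + k] over [k] *)

Definition binom (p k : nat) : R := INR (fact (p + k)) / (INR (fact p) * INR (fact k)).

Lemma binom_pos (p k : nat) : 0 < binom p k.
Proof.
apply Rdiv_lt_0_compat; [|apply Rmult_lt_0_compat]; apply INR_fact_lt_0.
Qed.

Lemma binom_pascal (p k : nat) :
  binom (S p) (S k) = binom p (S k) + binom (S p) k.
Proof.
unfold binom; replace (S p + S k)%nat with (S (S (p + k))) by lia.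
replace (p + S k)%nat with (S (p + k)) by lia.
replace (S p + k)%nat with (S (p + k)) by lia.
rewrite (fact_simpl (S (p + k))), !(fact_simpl p), !(fact_simpl k), !mult_INR, !S_INR, plus_INR.
generalize (pos_INR p) (pos_INR k) (INR_fact_lt_0 p) (INR_fact_lt_0 k); intros.
field; repeat split; lra.
Qed.

Lemma binom_0_r (p : nat) : binom p 0 = 1.
Proof.
unfold binom; rewrite Nat.add_0_r; simpl; field; apply INR_fact_neq_0.
Qed.

Lemma binom_0_l (k : nat) : binom 0 k = 1.
Proof. unfold binom; simpl; field; apply INR_fact_neq_0. Qed.

Lemma binom_incr_l (p k : nat) : binom p k <= binom (S p) k.
Proof.
destruct k as [|k]; [rewrite !binom_0_r; lra|].
rewrite binom_pascal; generalize (binom_pos (S p) k); lra.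
Qed.

Lemma binom_le_pow2 (p k : nat) : binom p k <= 2 ^ (p + k).
Proof.
remember (p + k)%nat as N eqn:HN; revert p k HN.
induction N as [|N IH]; intros p k HN.
- replace k with 0%nat by lia; rewrite binom_0_r; simpl; lra.
- assert (H1 : 1 <= 2 ^ S N) by (apply pow_R1_Rle; lra).
  destruct p as [|p]; [rewrite binom_0_l; exact H1|].
  destruct k as [|k]; [rewrite binom_0_r; exact H1|].
  rewrite binom_pascal; generalize (IH p (S k) ltac:(lia)) (IH (S p) k ltac:(lia)).
  simpl pow; lra.
Qed.

(** Integrating the system once brings a coefficient of order [p + 1] and a divisor [k + 1]; this
    identity absorbs both into the binomial coefficient. *)
Lemma binom_S_r (p k : nat) :
  binom p (S k) = (INR p + 1) * binom (S p) k / INR (S k).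
Proof.
unfold binom; replace (p + S k)%nat with (S p + k)%nat by lia.
rewrite (fact_simpl p), (fact_simpl k), !mult_INR, !S_INR.
generalize (pos_INR p) (pos_INR k) (INR_fact_lt_0 p) (INR_fact_lt_0 k); intros.
field; repeat split; lra.
Qed.

(** * The infinite system and its bounded solutions *)

Lemma offdiag_le (alpha m : nat) : offdiag alpha m <= INR m + INR alpha.
Proof.
generalize (pos_INR m) (pos_INR alpha); intros.
apply Rsqr_incr_0_var; [|lra].
rewrite !Rsqr_pow2, offdiag_sqr; nra.
Qed.

(** The system in the column index [m] for a fixed row of the group. At [m = 0] the term
    [w (pred m)] carries the coefficient [offdiag alpha 0 = 0]. *)
Definition jacobi_ode (alpha : nat) (w : nat -> R -> C) : Prop :=
  forall m t, is_derive_C (w m) t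
    (- Ci * (offdiag alpha m * w (pred m) t + diag alpha m * w m t
             + offdiag alpha (S m) * w (S m) t))%C.

(** Each induction step integrates the system once. The three coefficients add up to at most
    [4 (m + alpha + 1)], and passing to complex moduli costs a factor 2, hence the 8. *)
Lemma jacobi_ode_iterated_bound (alpha : nat) (w : nat -> R -> C) (M t0 : R) :
  jacobi_ode alpha w -> (forall m t, Cmod (w m t) <= M) ->
  (forall m, w m t0 = RtoC 0) ->
  forall k m t, Cmod (w m t) <= M * 8 ^ k * binom (m + alpha) k * Rabs (t - t0) ^ k.
Proof.
intros Hw HM H0 k; induction k as [|k IH]; intros m t.
- rewrite binom_0_r; simpl; generalize (HM m t); lra.
- assert (HM0 : 0 <= M) by (eapply Rle_trans; [apply Cmod_ge_0|apply (HM O 0)]).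
  generalize (Cmod_le_of_derive_le_pow (w m) _
    (4 * (INR (m + alpha) + 1) * (M * 8 ^ k * binom (S (m + alpha)) k)) k t0
    (H0 m) (Hw m)).
  intros G; eapply Rle_trans; [apply G|].
  + intros s; rewrite Cmod_mult, Cmod_opp, Cmod_Ci, Rmult_1_l.
    set (X := M * 8 ^ k * binom (S (m + alpha)) k * Rabs (s - t0) ^ k).
    (* One bound serves all neighbours up to [m + 1], since [binom] increases in its first argument;
       hence [S (m + alpha)]. *)
    assert (HX : forall j, (j <= S m)%nat -> Cmod (w j s) <= X).
    { assert (H8 : 0 <= M * 8 ^ k) by (apply Rmult_le_pos; [lra|apply pow_le; lra]).
      assert (HP : 0 <= Rabs (s - t0) ^ k) by (apply pow_le, Rabs_pos).
      assert (Mono : forall d p, binom p k <= binom (d + p) k).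
      { induction d as [|d IHd]; intros p; [apply Rle_refl|].
        eapply Rle_trans; [apply IHd|apply binom_incr_l]. }
      intros j Hj; eapply Rle_trans; [apply IH|unfold X].
      apply Rmult_le_compat_r; [exact HP|]; apply Rmult_le_compat_l; [exact H8|].
      replace (S (m + alpha)) with ((S m - j) + (j + alpha))%nat by lia; apply Mono. }
    generalize (offdiag_nonneg alpha m) (offdiag_nonneg alpha (S m))
      (offdiag_le alpha m) (offdiag_le alpha (S m)) (pos_INR m) (pos_INR alpha)
      (HX (pred m) ltac:(lia)) (HX m ltac:(lia)) (HX (S m) ltac:(lia))
      (Cmod_ge_0 (w (pred m) s)) (Cmod_ge_0 (w m s)) (Cmod_ge_0 (w (S m) s)).
    rewrite S_INR; intros.
    assert (Hdiag : 0 <= diag alpha m) by (unfold diag; lra).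
    eapply Rle_trans; [apply Cmod_triangle|].
    eapply Rle_trans; [apply Rplus_le_compat_r, Cmod_triangle|].
    rewrite !Cmod_mult, !Cmod_R, !Rabs_pos_eq by assumption.
    apply Rle_trans with (offdiag alpha m * X + diag alpha m * X + offdiag alpha (S m) * X).
    { apply Rplus_le_compat; [apply Rplus_le_compat|];
        apply Rmult_le_compat_l; assumption. }
    apply Rle_trans with (4 * (INR (m + alpha) + 1) * X); [|unfold X; apply Req_le; ring].
    rewrite plus_INR; unfold diag in *; nra.
  + rewrite binom_S_r; apply Req_le.
    simpl pow; field; apply not_0_INR; lia.
Qed.

Lemma le_0_of_le_half_pow (x K : R) : (forall k, x <= K * (1 / 2) ^ k) -> x <= 0.
Proof.
intros H.
assert (L : is_lim_seq (fun k => K * (1 / 2) ^ k) (K * 0)).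
{ apply (is_lim_seq_scal_l _ K 0), is_lim_seq_geom; rewrite Rabs_pos_eq; lra. }
rewrite Rmult_0_r in L.
exact (is_lim_seq_le _ _ x 0 H (is_lim_seq_const x) L).
Qed.

(** With [binom p k <= 2^(p+k)] the iterated bound is a constant times [(16 |t - t0|)^k], hence at
    most that constant times [(1/2)^k] on this interval. The radius depends neither on [t0] nor on
    [m], so the argument can be continued in time. *)
Lemma jacobi_ode_unique_local (alpha : nat) (w : nat -> R -> C) (M t0 : R) :
  jacobi_ode alpha w -> (forall m t, Cmod (w m t) <= M) ->
  (forall m, w m t0 = RtoC 0) ->
  forall m t, Rabs (t - t0) <= 1 / 32 -> w m t = RtoC 0.
Proof.
intros Hw HM H0 m t Ht; apply Cmod_eq_0, Rle_antisym; [|apply Cmod_ge_0].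
assert (HM0 : 0 <= M) by (eapply Rle_trans; [apply Cmod_ge_0|apply (HM O 0)]).
apply (le_0_of_le_half_pow _ (M * 2 ^ (m + alpha))); intros k.
eapply Rle_trans; [apply (jacobi_ode_iterated_bound alpha w M t0 Hw HM H0 k)|].
assert (Hk : 8 ^ k * (2 ^ k * (1 / 32) ^ k) = (1 / 2) ^ k)
  by (rewrite <- !Rpow_mult_distr; f_equal; lra).
rewrite <- Hk.
replace (M * 2 ^ (m + alpha) * (8 ^ k * (2 ^ k * (1 / 32) ^ k)))
  with (M * 8 ^ k * 2 ^ (m + alpha + k) * (1 / 32) ^ k) by (rewrite (pow_add 2 (m + alpha)); ring).
assert (H8 : 0 <= M * 8 ^ k) by (apply Rmult_le_pos; [lra|apply pow_le; lra]).
apply Rmult_le_compat.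
- apply Rmult_le_pos; [exact H8|apply Rlt_le, binom_pos].
- apply pow_le, Rabs_pos.
- apply Rmult_le_compat_l; [exact H8|apply binom_le_pow2].
- apply pow_incr; split; [apply Rabs_pos|exact Ht].
Qed.

Lemma jacobi_ode_unique (alpha : nat) (w : nat -> R -> C) (M : R) :
  jacobi_ode alpha w -> (forall m t, Cmod (w m t) <= M) ->
  (forall m, w m 0 = RtoC 0) -> forall m t, w m t = RtoC 0.
Proof.
intros Hw HM H0 m t.
(* [N] exceeds [32 |t|], so [N] equal steps of length at most 1/32 lead from 0 to [t]. *)
destruct (INR_archimed (1 / 32) (Rabs t) ltac:(lra)) as [N HN].
assert (HN0 : 0 < INR N) by (generalize (Rabs_pos t); nra).
assert (Step : forall j m, w m (INR j * (t / INR N)) = RtoC 0).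
{ induction j as [|j IH]; intros p.
  - simpl INR; rewrite Rmult_0_l; apply H0.
  - apply (jacobi_ode_unique_local alpha w M _ Hw HM IH).
    rewrite S_INR; replace (_ - _) with (t / INR N) by ring.
    unfold Rdiv; rewrite Rabs_mult, (Rabs_pos_eq (/ INR N))
      by (apply Rlt_le, Rinv_0_lt_compat; lra).
    apply (Rmult_le_reg_r (INR N)); [lra|].
    rewrite Rmult_assoc, Rinv_l; lra. }
rewrite <- (Step N m); f_equal; field; lra.
Qed.

(** * The unitary group *)

Lemma Rbar_lub_correct (E : Rbar -> Prop) : Rbar_is_lub E (Rbar_lub E).
Proof. unfold Rbar_lub; now destruct (Rbar_ex_lub E). Qed.

(** * Series and sequence spaces *)

Lemma ex_series_scal_real (c : R) (a : nat -> R) :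
  ex_series a -> ex_series (fun n => c * a n).
Proof. exact (ex_series_scal (V := R_NormedModule) c a). Qed.

Lemma is_series_single (a : nat -> R) (m : nat) :
  (forall n, n <> m -> a n = 0) -> is_series a (a m).
Proof.
intros H.
assert (Hs : forall N, sum_n a N = if le_dec m N then a m else 0).
{ induction N as [|N IH].
  - rewrite sum_O; destruct (le_dec m 0) as [h|h].
    + now replace m with 0%nat by lia.
    + apply H; lia.
  - rewrite sum_Sn, IH; unfold plus; simpl.
    destruct (le_dec m N), (le_dec m (S N)); try lia.
    + rewrite (H (S N)) by lia; ring.
    + replace (S N) with m by lia; ring.
    + rewrite (H (S N)) by lia; ring. }
apply (filterlim_ext_loc (fun _ => a m)); [|apply filterlim_const].
exists m; intros N HN; rewrite Hs; destruct (le_dec m N); [reflexivity|lia].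
Qed.

Lemma Series_single (a : nat -> R) (m : nat) :
  (forall n, n <> m -> a n = 0) -> Series a = a m.
Proof. intros H; now apply is_series_unique, is_series_single. Qed.

Lemma delta_eq (m : nat) : delta m m = RtoC 1.
Proof. unfold delta; now rewrite Nat.eqb_refl. Qed.

Lemma delta_neq (m n : nat) : n <> m -> delta m n = RtoC 0.
Proof. intros H; unfold delta; destruct (Nat.eqb_spec m n); congruence. Qed.

Lemma in_l2_delta (m : nat) : in_l2 (delta m).
Proof.
eexists; apply (is_series_single _ m); intros n Hn.
rewrite delta_neq, Cmod_0 by exact Hn; ring.
Qed.

(** Termwise comparison through [(x + y)^2 <= 2 x^2 + 2 y^2]. *)
Lemma in_l2_comb (a b : C) (u v : nat -> C) :
  in_l2 u -> in_l2 v -> in_l2 (fun n => a * u n + b * v n)%C.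
Proof.
intros Hu Hv.
apply (ex_series_le (K := R_AbsRing) (V := R_CompleteNormedModule) _
  (fun n => 2 * Cmod a ^ 2 * Cmod (u n) ^ 2 + 2 * Cmod b ^ 2 * Cmod (v n) ^ 2)).
- intros n; change (Rabs (Cmod (a * u n + b * v n)%C ^ 2) <=
    2 * Cmod a ^ 2 * Cmod (u n) ^ 2 + 2 * Cmod b ^ 2 * Cmod (v n) ^ 2).
  rewrite Rabs_pos_eq by apply pow2_ge_0.
  generalize (Cmod_triangle (a * u n) (b * v n)) (Cmod_ge_0 (a * u n + b * v n)).
  rewrite !Cmod_mult; intros H H0.
  apply Rle_trans with ((Cmod a * Cmod (u n) + Cmod b * Cmod (v n)) ^ 2);
    [apply pow_incr; lra|].
  generalize (pow2_ge_0 (Cmod a * Cmod (u n) - Cmod b * Cmod (v n))); lra.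
- apply (ex_series_plus (V := R_NormedModule));
    apply ex_series_scal_real; assumption.
Qed.

(** The terms of a summable sequence eventually have modulus below 1, and from then on the squares
    are dominated by the moduli. *)
Lemma in_l1_in_l2 (u : nat -> C) : in_l1 u -> in_l2 u.
Proof.
intros Hu.
assert (L : is_lim_seq (fun n => Cmod (u n)) 0) by now apply ex_series_lim_0.
apply is_lim_seq_spec in L; destruct (L (mkposreal 1 Rlt_0_1)) as [N HN].
apply (ex_series_incr_n (fun n => Cmod (u n) ^ 2) N).
apply (ex_series_le (K := R_AbsRing) (V := R_CompleteNormedModule) _
  (fun n => Cmod (u (N + n)%nat))); [|now apply (ex_series_incr_n (fun n => Cmod (u n)) N)].
intros n; change (Rabs (Cmod (u (N + n)%nat) ^ 2) <= Cmod (u (N + n)%nat)).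
rewrite Rabs_pos_eq by apply pow2_ge_0.
generalize (HN (N + n)%nat ltac:(lia)) (Cmod_ge_0 (u (N + n)%nat)); simpl.
rewrite Rminus_0_r; intros H H0; rewrite Rabs_pos_eq in H by exact H0; nra.
Qed.

Lemma Cmod_le_norm_l2 (u : nat -> C) (n : nat) : in_l2 u -> Cmod (u n) <= norm_l2 u.
Proof.
intros Hu; unfold norm_l2.
rewrite <- (sqrt_pow2 (Cmod (u n))) by apply Cmod_ge_0; apply sqrt_le_1_alt.
set (a := fun k => if Nat.eq_dec k n then Cmod (u n) ^ 2 else 0).
assert (E : Series a = Cmod (u n) ^ 2).
{ rewrite (Series_single a n); unfold a; [|intros k Hk]; destruct (Nat.eq_dec _ _); congruence. }
rewrite <- E; apply Series_le; [|exact Hu].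
intros k; unfold a; generalize (pow2_ge_0 (Cmod (u k))) (pow2_ge_0 (Cmod (u n))).
destruct (Nat.eq_dec k n) as [->|]; lra.
Qed.

Lemma norm_l2_delta (m : nat) : norm_l2 (delta m) = 1.
Proof.
unfold norm_l2.
rewrite (Series_single _ m)
  by (intros n Hn; rewrite delta_neq, Cmod_0 by exact Hn; ring).
rewrite delta_eq, Cmod_1, pow1; apply sqrt_1.
Qed.

Lemma inner_l2_self (u : nat -> C) : Re (inner_l2 u u) = Series (fun n => Cmod (u n) ^ 2).
Proof.
apply Series_ext; intros n; rewrite Cmod2_alt; unfold Re, Im; simpl; ring.
Qed.

Lemma inner_l2_delta_l (n : nat) (v : nat -> C) : inner_l2 (delta n) v = v n.
Proof.
unfold inner_l2.
rewrite (Series_single (fun k => Re (Cconj (delta n k) * v k)) n)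
  by (intros k Hk; rewrite delta_neq by exact Hk; unfold Re; simpl; ring).
rewrite (Series_single (fun k => Im (Cconj (delta n k) * v k)) n)
  by (intros k Hk; rewrite delta_neq by exact Hk; unfold Im; simpl; ring).
rewrite delta_eq; apply injective_projections; unfold Re, Im; simpl; ring.
Qed.

Lemma inner_l2_delta_r (g : nat -> C) (m : nat) : inner_l2 g (delta m) = Cconj (g m).
Proof.
unfold inner_l2.
rewrite (Series_single (fun k => Re (Cconj (g k) * delta m k)) m)
  by (intros k Hk; rewrite delta_neq by exact Hk; unfold Re; simpl; ring).
rewrite (Series_single (fun k => Im (Cconj (g k) * delta m k)) m)
  by (intros k Hk; rewrite delta_neq by exact Hk; unfold Im; simpl; ring).
rewrite delta_eq; apply injective_projections; unfold Re, Im; simpl; ring.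
Qed.

(* With [S] the sum of the [z n], [|S| ^ 2] is the sum of the
   [Re (Cconj S * z n) <= |S| * |z n|]. *)
Lemma Cmod_Series_le (z : nat -> C) :
  ex_series (fun n => Cmod (z n)) ->
  Cmod (Series (fun n => Re (z n)), Series (fun n => Im (z n))) <=
  Series (fun n => Cmod (z n)).
Proof.
intros H.
assert (Hr : ex_series (fun n => Re (z n))).
{ apply (ex_series_le (K := R_AbsRing) (V := R_CompleteNormedModule) _ (fun n => Cmod (z n)));
    [intros n; apply re_le_Cmod|exact H]. }
assert (Hi : ex_series (fun n => Im (z n))).
{ apply (ex_series_le (K := R_AbsRing) (V := R_CompleteNormedModule) _ (fun n => Cmod (z n)));
    [intros n; apply Im_le_Cmod|exact H]. }
set (a := Series (fun n => Re (z n))); set (b := Series (fun n => Im (z n))).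
set (s := Cmod (a, b)).
assert (Hs0 : 0 <= s) by apply Cmod_ge_0.
assert (Hs : s ^ 2 <= s * Series (fun n => Cmod (z n))).
{ replace (s ^ 2) with (a * a + b * b)
    by (unfold s; rewrite Cmod2_alt; unfold Re, Im; simpl; ring).
  unfold a at 2, b at 2; rewrite <- !Series_scal_l.
  rewrite <- Series_plus by now apply ex_series_scal_real.
  eapply Rle_trans; [apply Rle_abs|].
  assert (Hle : forall n, Rabs (a * Re (z n) + b * Im (z n)) <= s * Cmod (z n)).
  { intros n; unfold s; rewrite <- (Cmod_conj (a, b)), <- Cmod_mult.
    eapply Rle_trans; [|apply re_le_Cmod].
    apply Req_le; f_equal; unfold Re, Im; simpl; ring. }
  assert (Hex : ex_series (fun n => s * Cmod (z n)))
    by now apply ex_series_scal_real.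
  eapply Rle_trans.
  - apply Series_Rabs.
    apply (ex_series_le (K := R_AbsRing) (V := R_CompleteNormedModule) _
      (fun n => s * Cmod (z n))); [|exact Hex].
    intros n; change (Rabs (Rabs (a * Re (z n) + b * Im (z n))) <= s * Cmod (z n)).
    rewrite Rabs_Rabsolu; apply Hle.
  - apply Series_le; [|exact Hex].
    intros n; split; [apply Rabs_pos|apply Hle]. }
destruct (Req_dec s 0) as [E|E].
- rewrite E.
  rewrite <- (Series_single (fun _ => 0) 0) by reflexivity.
  apply Series_le; [|exact H]; intros n; split; [lra|apply Cmod_ge_0].
- apply (Rmult_le_reg_l s); [lra|]; simpl in Hs; lra.
Qed.

(** Hölder's inequality for the pairing of l^infty with l^1. *)
Lemma Cmod_inner_l2_le (g u : nat -> C) (c : R) :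
  (forall m, Cmod (g m) <= c) -> in_l1 u -> Cmod (inner_l2 g u) <= c * norm_l1 u.
Proof.
intros Hg Hu.
assert (Hle : forall n, 0 <= Cmod (Cconj (g n) * u n)%C <= c * Cmod (u n)).
{ intros n; split; [apply Cmod_ge_0|].
  rewrite Cmod_mult, Cmod_conj; apply Rmult_le_compat_r; [apply Cmod_ge_0|apply Hg]. }
assert (Hc : ex_series (fun n => c * Cmod (u n)))
  by now apply ex_series_scal_real.
unfold inner_l2; eapply Rle_trans.
- apply (Cmod_Series_le (fun n => Cconj (g n) * u n)%C).
  apply (ex_series_le (K := R_AbsRing) (V := R_CompleteNormedModule) _
    (fun n => c * Cmod (u n))); [|exact Hc].
  intros n; change (Rabs (Cmod (Cconj (g n) * u n)%C) <= c * Cmod (u n)).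
  rewrite Rabs_pos_eq; apply Hle.
- unfold norm_l1; rewrite <- Series_scal_l; apply Series_le; assumption.
Qed.

(** * Unitary operators and the group on basis vectors *)

Lemma norm_l2_unitary (T : (nat -> C) -> nat -> C) (u : nat -> C) :
  is_unitary T -> in_l2 u -> norm_l2 (T u) = norm_l2 u.
Proof.
intros HT Hu; unfold norm_l2; rewrite <- !inner_l2_self.
now rewrite (unitary_inner _ HT).
Qed.

(** The factor [RtoC 1] gives the right side the nested form [a * u + b * v] that [in_l2_comb] and
    [unitary_linear] expect. *)
Lemma tau_delta (alpha m : nat) :
  tau (INR alpha) (delta m) =
  (fun n => offdiag alpha m * delta (pred m) n + RtoC 1 * (diag alpha m * delta m n
            + offdiag alpha (S m) * delta (S m) n))%C.
Proof.
apply functional_extensionality; intros n; unfold tau.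
assert (H0 : offdiag alpha 0 = 0)
  by (unfold offdiag; simpl; now rewrite Rmult_0_l, sqrt_0).
fold (offdiag alpha n).
replace (sqrt ((INR n + 1) * (INR n + 1 + INR alpha))) with (offdiag alpha (S n))
  by (unfold offdiag; now rewrite S_INR).
fold (diag alpha n).
unfold delta.
destruct n as [|n], m as [|m]; rewrite ?H0; cbn [pred];
  repeat (match goal with |- context [Nat.eqb ?a ?b] => destruct (Nat.eqb_spec a b) end;
          try (exfalso; lia));
  subst; try ring.
all: repeat match goal with H : S _ = S _ |- _ => injection H as H; subst end; try ring.
Qed.

(** By the group law and linearity, the error of the difference quotient at [t] is the image under
    [U t] of the error at 0. Since [U t] is isometric, it tends to 0 in l^2, and each component is
    bounded by the norm. *)
Lemma exp_group_component_derive (A : operator) (U : R -> (nat -> C) -> (nat -> C))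
  (u : nat -> C) (n : nat) (t : R) :
  is_exp_group A U -> in_l2 u -> dom A u -> in_l2 (act A u) ->
  is_derive_C (fun s => U s u n) t (- Ci * U t (act A u) n)%C.
Proof.
intros HU Hu Hdom Hv.
set (v := act A u) in *.
generalize (proj1 (exp_generator _ _ HU u v Hu Hv) (conj Hdom eq_refl)); intros L.
apply is_lim_spec in L.
assert (HUt := exp_unitary _ _ HU t).
(* True for [h = 0] as well: the quotient is only used as multiplication by [/ RtoC h]. *)
assert (Key : forall h, norm_l2 (fun n => (U h u n - u n) / RtoC h - (- Ci * v n))%C =
   norm_l2 (fun n => (U (t + h)%R u n - U t u n) / RtoC h - (- Ci * U t v n))%C
   /\ in_l2 (fun n => (U (t + h)%R u n - U t u n) / RtoC h - (- Ci * U t v n))%C).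
{ intros h.
  assert (Huh : in_l2 (U h u)) by (apply (unitary_maps _ (exp_unitary _ _ HU h)); exact Hu).
  assert (Hq : in_l2 (fun n => / RtoC h * U h u n + (- / RtoC h) * u n)%C)
    by now apply in_l2_comb.
  assert (Hq' : in_l2 (fun n => 1 * (/ RtoC h * U h u n + (- / RtoC h) * u n) + Ci * v n)%C)
    by now apply (in_l2_comb 1 Ci (fun n => / RtoC h * U h u n + (- / RtoC h) * u n)%C).
  assert (E1 : (fun n => (U h u n - u n) / RtoC h - (- Ci * v n))%C =
     (fun n => 1 * (/ RtoC h * U h u n + (- / RtoC h) * u n) + Ci * v n)%C)
    by (apply functional_extensionality; intros k; unfold Cdiv; ring).
  assert (E2 : (fun n => (U (t + h)%R u n - U t u n) / RtoC h - (- Ci * U t v n))%C =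
     U t (fun n => 1 * (/ RtoC h * U h u n + (- / RtoC h) * u n) + Ci * v n)%C).
  { rewrite (unitary_linear _ HUt 1 Ci
      (fun n => / RtoC h * U h u n + (- / RtoC h) * u n)%C v Hq Hv).
    rewrite (unitary_linear _ HUt _ _ _ _ Huh Hu), (exp_add _ _ HU t h u Hu).
    apply functional_extensionality; intros k; unfold Cdiv; ring. }
  rewrite E1, E2; split; [|now apply (unitary_maps _ HUt)].
  symmetry; now apply norm_l2_unitary. }
assert (Lim : forall eps, 0 < eps -> exists d : posreal, forall h, h <> 0 -> Rabs h < d ->
   Cmod ((U (t + h)%R u n - U t u n) / RtoC h - (- Ci * U t v n))%C < eps).
{ intros eps Heps; destruct (L (mkposreal eps Heps)) as [d Hd]; exists d; intros h Hh0 Hh.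
  assert (Hb : ball 0 d h).
  { change (Rabs (h - 0) < d); now rewrite Rminus_0_r. }
  generalize (Hd h Hb Hh0); simpl; rewrite Rminus_0_r, (proj1 (Key h)); intros Hlt.
  eapply Rle_lt_trans; [exact (Cmod_le_norm_l2 _ n (proj2 (Key h)))|].
  eapply Rle_lt_trans; [apply Rle_abs|exact Hlt]. }
split; apply is_derive_Reals; intros eps Heps; destruct (Lim eps Heps) as [d Hd];
  exists d; intros h Hh0 Hh; (eapply Rle_lt_trans; [|exact (Hd h Hh0 Hh)]).
- eapply Rle_trans; [|apply re_le_Cmod]; apply Req_le, (f_equal Rabs).
  unfold Cdiv; rewrite <- RtoC_inv by exact Hh0.
  match goal with |- ?x = ?y => change (@eq R x y) end.
  unfold Re; simpl; field; exact Hh0.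
- eapply Rle_trans; [|apply Im_le_Cmod]; apply Req_le, (f_equal Rabs).
  unfold Cdiv; rewrite <- RtoC_inv by exact Hh0.
  match goal with |- ?x = ?y => change (@eq R x y) end.
  unfold Im; simpl; field; exact Hh0.
Qed.

(** [delta m] lies in the domain because its image combines at most three basis vectors; expanding
    [U t] of that image by linearity gives the system in [m]. *)
Lemma exp_group_delta_ode (alpha n : nat) (U : R -> (nat -> C) -> (nat -> C)) :
  is_exp_group (H_op (INR alpha)) U -> jacobi_ode alpha (fun m t => U t (delta m) n).
Proof.
intros HU m t.
assert (Hin : in_l2 (fun n => diag alpha m * delta m n
            + offdiag alpha (S m) * delta (S m) n)%C)
  by (apply in_l2_comb; apply in_l2_delta).
assert (Ht : in_l2 (tau (INR alpha) (delta m))).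
{ rewrite tau_delta.
  apply (in_l2_comb _ 1 _ (fun n => diag alpha m * delta m n
            + offdiag alpha (S m) * delta (S m) n)%C); [apply in_l2_delta|exact Hin]. }
evar_last.
- apply (exp_group_component_derive _ U (delta m) n t HU (in_l2_delta m));
    [split; [apply in_l2_delta|exact Ht]|exact Ht].
- assert (HUt := exp_unitary _ _ HU t).
  cbn [act H_op]; rewrite tau_delta.
  rewrite (unitary_linear _ HUt _ 1 _ (fun n => diag alpha m * delta m n
            + offdiag alpha (S m) * delta (S m) n)%C (in_l2_delta _) Hin).
  rewrite (unitary_linear _ HUt) by apply in_l2_delta; ring.
Qed.

Lemma exp_group_kernel (alpha n m : nat) (U : R -> (nat -> C) -> (nat -> C)) (t : R) :
  is_exp_group (H_op (INR alpha)) U -> U t (delta m) n = kernel alpha n m t.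
Proof.
intros HU.
assert (E : forall m t, (U t (delta m) n - kernel alpha n m t)%C = RtoC 0).
{ apply (jacobi_ode_unique alpha (fun m t => U t (delta m) n - kernel alpha n m t)%C 2).
  - intros j s; evar_last.
    + apply is_derive_C_minus; [apply (exp_group_delta_ode alpha n U HU j s)|
        apply kernel_derive].
    + cbn beta; ring.
  - intros j s; unfold Cminus; eapply Rle_trans; [apply Cmod_triangle|].
    rewrite Cmod_opp.
    assert (HUs := exp_unitary _ _ HU s).
    assert (H1 : Cmod (U s (delta j) n) <= 1).
    { rewrite <- (norm_l2_delta j), <- (norm_l2_unitary _ _ HUs (in_l2_delta j)).
      apply Cmod_le_norm_l2, (unitary_maps _ HUs), in_l2_delta. }
    assert (H2 : 1 / sqrt (1 + s ^ 2) <= 1).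
    { assert (Hq : 1 <= sqrt (1 + s ^ 2))
        by (rewrite <- sqrt_1 at 1; apply sqrt_le_1_alt; generalize (pow2_ge_0 s); lra).
      apply (Rmult_le_reg_r (sqrt (1 + s ^ 2))); [lra|].
      unfold Rdiv; rewrite Rmult_assoc, Rinv_l; lra. }
    generalize (Cmod_kernel_le alpha n j s); lra.
  - intros j; rewrite (exp_zero _ _ HU _ (in_l2_delta j)), kernel_0; ring. }
generalize (E m t); intros H.
replace (kernel alpha n m t) with (kernel alpha n m t + (U t (delta m) n - kernel alpha n m t))%C
  by (rewrite H; ring); ring.
Qed.

(** Surjectivity provides [g] with [U t g = delta n], so the component [n] of [U t u] is the inner
    product of [g] with [u]. The entries of [g] are conjugates of kernel values, and no expansion of
    [u] in basis vectors is required. *)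
Lemma exp_group_l1_bound (alpha : nat) (U : R -> (nat -> C) -> (nat -> C)) (t : R)
  (u : nat -> C) (n : nat) :
  is_exp_group (H_op (INR alpha)) U -> in_l1 u ->
  Cmod (U t u n) <= 1 / sqrt (1 + t ^ 2) * norm_l1 u.
Proof.
intros HU Hu.
assert (HUt := exp_unitary _ _ HU t).
destruct (unitary_surj _ HUt (delta n) (in_l2_delta n)) as [g [Hg Eg]].
assert (Hn : forall v, in_l2 v -> U t v n = inner_l2 g v).
{ intros v Hv; rewrite <- (inner_l2_delta_l n (U t v)), <- Eg.
  now apply (unitary_inner _ HUt). }
rewrite Hn by now apply in_l1_in_l2.
apply Cmod_inner_l2_le; [|exact Hu].
intros m; rewrite <- Cmod_conj, <- inner_l2_delta_r, <- Hn by apply in_l2_delta.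
rewrite (exp_group_kernel alpha n m U t HU); apply Cmod_kernel_le.
Qed.

Theorem theorem6p1 :
  forall (alpha : nat) (U : R -> (nat -> C) -> (nat -> C)),
    is_exp_group (H_op (INR alpha)) U ->
    (forall t : R,
       Rbar_le (norm_l1_linf (U t)) (Finite (1 / sqrt (1 + t ^ 2)))) /\
    (alpha = 0%nat ->
     forall t : R, norm_l1_linf (U t) = Finite (1 / sqrt (1 + t ^ 2))).
Proof.
intros alpha U HU.
assert (Upper : forall t, Rbar_le (norm_l1_linf (U t)) (Finite (1 / sqrt (1 + t ^ 2)))).
(* Both norms are least upper bounds, so it suffices to bound each component over the unit ball of
   l^1. *)
{ intros t; apply (proj2 (Rbar_lub_correct _)).
  intros y [u [Hu [Hn ->]]]; unfold norm_linf; rewrite Rbar_sup_eq_lub.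
  apply (proj2 (Rbar_lub_correct _)); intros x [n ->]; cbn [Rbar_le].
  eapply Rle_trans; [apply (exp_group_l1_bound alpha U t u n HU Hu)|].
  rewrite <- (Rmult_1_r (1 / sqrt (1 + t ^ 2))) at 2.
  apply Rmult_le_compat_l; [|exact Hn].
  apply Rlt_le, Rdiv_lt_0_compat; [lra|].
  apply sqrt_lt_R0; generalize (pow2_ge_0 t); lra. }
split; [exact Upper|].
intros -> t; apply Rbar_le_antisym; [apply Upper|].
assert (Hd : is_series (fun n => Cmod (delta 0 n)) (Cmod (delta 0 0))).
{ apply (is_series_single (fun n => Cmod (delta 0 n))); intros n Hn; now rewrite delta_neq, Cmod_0. }
(* The bound is attained by the unit vector [delta 0] at component 0, where the kernel equals
   [1/(1+it)]. *)
apply Rbar_le_trans with (norm_linf (U t (delta 0))).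
- unfold norm_linf; apply Sup_seq_minor_le with (n := 0%nat).
  rewrite (exp_group_kernel 0 0 0 U t HU); unfold kernel.
  replace (weight 0 0 / weight 0 0) with 1 by (field; apply Rgt_not_eq, weight_pos).
  replace (poly_coef _ _ _ _) with (RtoC 1) by reflexivity.
  cbn [plus]; rewrite Cpow_1_r, !Cmod_mult, !Cmod_1, Cmod_inv, Cmod_one_plus_imag
    by apply one_plus_imag_neq_0.
  unfold Rdiv; cbn [Rbar_le]; lra.
- apply (proj1 (Rbar_lub_correct _)); exists (delta 0); split; [now exists (Cmod (delta 0 0))|split; [|reflexivity]].
  unfold norm_l1; rewrite (is_series_unique _ _ Hd), delta_eq, Cmod_1; lra.
Qed.
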